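(* Let $n\ge1$ and let $|\psi\rangle\in\mathcal H^{\otimes n}$ be a pure state. Then $\Delta_{|\psi\rangle}(\hat H_{\mathrm{coll}})= n^2\max_{1\le i\le n}\Delta_{|\psi\rangle}(\hat H_i)$ if and only if $\Delta_{|\psi\rangle}(\hat P_j)=0$ for all $j\in\{2,\dots,n\}$. Moreover, the latter condition implies that $\Delta_{|\psi\rangle}(\hat H_i)=\Delta_{|\psi\rangle}(\hat H_j)$ for all $i,j$.
   Context: $\mathcal H$ is a complex Hilbert space (finite or infinite-dimensional), $\hat H$ is a self-adjoint operator on $\mathcal H$ with non-degenerate spectrum. On $\mathcal H^{\otimes n}$, $\hat H_i=\mathbf 1^{\otimes(i-1)}\otimes\hat H\otimes\mathbf 1^{\otimes(n-i)}$ and $\hat H_{\mathrm{coll}}=\sum_{i=1}^n\hat H_i$. Fix a real orthogonal $n\times n$ matrix $(\alpha_{ij})$ with $\alpha_{1j}=1/\sqrt n$ for all $j$, and set $\hat P_i=\sum_{j=1}^n\alpha_{ij}\hat H_j$ (so $\hat P_1=\hat H_{\mathrm{coll}}/\sqrt n$). Pure states are unit vectors; $\Delta_{|\psi\rangle}(\hat A)=\langle\psi|\hat A^2|\psi\rangle-\langle\psi|\hat A|\psi\rangle^2$ denotes the variance. If $\hat H$ is unbounded, only states lying in the domain of every $\hat H_i$ (so that all variances are finite) are considered. *)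

(* Defs.v *)
From HB Require Import structures.
From mathcomp Require Import all_boot all_order all_algebra.
From mathcomp Require Import complex ring.
From mathcomp Require Import all_classical all_reals all_analysis.

Set Implicit Arguments.
Unset Strict Implicit.
Unset Printing Implicit Defensive.

Import Order.TTheory GRing.Theory Num.Theory.
Import numFieldNormedType.Exports.

Local Open Scope classical_set_scope.
Local Open Scope complex_scope.
Local Open Scope ring_scope.

(* Complex Hilbert spaces. As everywhere in {dot _ for _}, the inner product
   is linear in its FIRST argument and conjugate-linear in the second, so
   <psi|A|phi> is written ip (A phi) psi. *)
HB.mixin Record isHilbert (R : realType) V of CompleteNormedModule R[i] V := {
  ip : {dot V for Num.conj} ;
  ip_norm : forall x : V, ip x x = `|x| ^+ 2 }.

#[short(type="hilbertType")]
HB.structure Definition Hilbert (R : realType) :=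
  {V of isHilbert R V & CompleteNormedModule R[i] V}.

Section Operators.
Context {R : realType}.
Local Notation C := R[i].

Definition lin_span (V : lmodType C) (S : set V) : set V :=
  [set x | exists (m : nat) (c : 'I_m -> C) (s : 'I_m -> V),
     (forall k, S (s k)) /\ x = \sum_(k < m) c k *: s k].

(* A possibly unbounded, partially defined operator is represented by its
   graph: A (x, y) means that x is in the domain of A and A x = y. *)
Section OnHilbert.
Variable V : hilbertType R.
Implicit Types (A : set (V * V)) (x y psi : V).

Definition is_operator A : Prop :=
  [/\ A 0, forall (c : C) p q, A p -> A q -> A (c *: p + q)
    & forall y, A (0, y) -> y = 0].

Definition op_dom A : set V := [set x | exists y, A (x, y)].

Definition op_app A x : V := xget 0 [set y | A (x, y)].

Definition op_adjoint A : set (V * V) :=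
  [set p | forall q, A q -> ip q.2 p.1 = ip q.1 p.2].

Definition self_adjoint A : Prop :=
  [/\ is_operator A, dense (op_dom A) & op_adjoint A = A].

Definition op_scale (c : C) A : set (V * V) :=
  [set p | exists2 y, A (p.1, y) & p.2 = c *: y].

(* The domain of the sum is the intersection of the domains. *)
Definition op_sum n (A : 'I_n -> set (V * V)) : set (V * V) :=
  [set p | exists y : 'I_n -> V,
     (forall i, A i (p.1, y i)) /\ p.2 = \sum_(i < n) y i].

Definition op_commute (B : V -> V) A : Prop :=
  forall p, A p -> A (B p.1, B p.2).

(* Non-degenerate (simple, multiplicity-free) spectrum, in the form that also
   covers continuous spectrum and non-separable spaces: the bounded operators
   commuting with A commute with each other, i.e. A alone is a complete set of
   commuting observables. For pure point spectrum, in particular in finite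
   dimension, this says that all eigenvalues are simple: see
   nondegenerate_spectrumP below. *)
Definition nondegenerate_spectrum A : Prop :=
  forall B D : {linear V -> V}, continuous B -> continuous D ->
    op_commute B A -> op_commute D A -> forall x, B (D x) = D (B x).

Lemma ip_conj (x y : V) : ip y x = (ip x y)^*.
Proof. by rewrite hermC expr0 mul1r. Qed.

Lemma ipBl (x y z : V) : ip (x - y) z = ip x z - ip y z.
Proof. by rewrite linearBl. Qed.
Lemma ipZl (x y : V) c : ip (c *: x) y = c * ip x y.
Proof. by rewrite linearZl_LR. Qed.
Lemma ipBr (x y z : V) : ip z (x - y) = ip z x - ip z y.
Proof. by rewrite linearBr. Qed.
Lemma ipZr (x y : V) c : ip y (c *: x) = c^* * ip y x.
Proof. by rewrite linearZr. Qed.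

Lemma ip_CauchySchwarz (x y : V) : `|ip x y| <= `|x| * `|y|.
Proof.
have [->|y0] := eqVneq y 0; first by rewrite linear0r !normr0 mulr0.
have yy : ip y y != 0 by rewrite ip_norm expf_neq0 // normr_eq0.
have yR : (ip y y)^* = ip y y by rewrite -ip_conj.
rewrite -(@ler_pXn2r _ 2) ?nnegrE ?mulr_ge0// exprMn -!ip_norm normCK -ip_conj.
have : 0 <= ip (x - (ip x y / ip y y) *: y) (x - (ip x y / ip y y) *: y).
  by rewrite ip_norm exprn_ge0.
rewrite !(ipBl, ipBr, ipZl, ipZr) rmorphM fmorphV /= yR -ip_conj.
rewrite -subr_ge0 -(pmulr_lge0 (x := ip y y)); last first.
  by rewrite ip_norm exprn_gt0// normr_gt0.
set a := ip x x; set b := ip y y; set d := ip x y; set e := ip y x.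
suff -> : (a - e / b * d - (d / b * e - d / b * (e / b * b))) * b = a * b - d * e by [].
by field.
Qed.

Lemma rank1_linear (u v : V) : linear (fun x : V => ip x u *: v).
Proof. by move=> c x y /=; rewrite linearPl scalerDl scalerA. Qed.

Definition rank1 (u v x : V) : V := ip x u *: v.

HB.instance Definition _ u v :=
  GRing.isLinear.Build C V V *:%R (rank1 u v) (rank1_linear u v).

Lemma rank1_continuous (u v : V) : continuous (rank1 u v).
Proof.
apply: (@bounded_linear_continuous _ V V (rank1 u v)).
apply/linear_boundedP; near=> r => x; rewrite /rank1 normrZ.
rewrite (le_trans (ler_wpM2r (normr_ge0 v) (ip_CauchySchwarz x u)))//.
rewrite -mulrA mulrC; apply: ler_wpM2r; first exact: normr_ge0.
near: r.
by apply: nbhs_pinfty_ge; rewrite ger0_real// mulr_ge0.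
Unshelve. all: by end_near. Qed.

Lemma nondegenerate_spectrumP (A : set (V * V)) :
    self_adjoint A -> dense (lin_span [set x | exists l : C, A (x, l *: x)]) ->
  nondegenerate_spectrum A <->
  forall (l : C) x y, x != 0 -> A (x, l *: x) -> A (y, l *: y) ->
    exists c : C, y = c *: x.
Proof.
move=> [[A0 Alin _] _ Aadj] Aspan.
have Asc c x y : A (x, y) -> A (c *: x, c *: y).
  by move=> xy; have := Alin c _ _ xy A0; rewrite addr0.
have Asym p q : A p -> A q -> ip q.2 p.1 = ip q.1 p.2.
  by rewrite -{1}Aadj => /[apply].
split=> [nondeg l u y u0 Au Ay|simple B D cB cD BA DA].
  have uu : ip u u != 0 by rewrite ip_norm expf_neq0 // normr_eq0.
  have lR : l^* = l.
    have := Asym _ _ Au Au; rewrite /= ipZl ipZr => /esym.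
    exact: mulIf.
  have com w : A (w, l *: w) -> op_commute (rank1 u w) A.
    move=> Aw p Ap; rewrite /rank1.
    have -> : ip p.2 u = ip p.1 u * l by rewrite (Asym _ _ Au Ap)/= ipZr lR mulrC.
    by rewrite -scalerA; exact: Asc.
  have := nondeg (rank1 u u) (rank1 u y) (@rank1_continuous u u) (@rank1_continuous u y)
    (com _ Au) (com _ Ay) u.
  rewrite /= /rank1 !ipZl => e; exists (ip y u / ip u u).
  apply: (scalerI (mulf_neq0 uu uu)).
  rewrite -e !scalerA; congr (_ *: _); by field.
have eig x : (exists l : C, A (x, l *: x)) -> B (D x) = D (B x).
  case=> l Ax; have [->|x0] := eqVneq x 0; first by rewrite !linear0.
  have := BA _ Ax; rewrite /= linearZ /= => /(simple _ _ _ x0 Ax)[b Bx].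
  have := DA _ Ax; rewrite /= linearZ /= => /(simple _ _ _ x0 Ax)[d Dx].
  by rewrite Bx Dx !linearZ/= Bx Dx !scalerA mulrC.
move=> x; apply/eqP/negPn/negP => BDx.
have cBD : continuous (fun z => B (D z) - D (B z)).
  move=> z; apply: cvgB.
    exact: (continuous_comp (cD z) (cB (D z))).
  exact: (continuous_comp (cB z) (cD (B z))).
have oBD : open [set z | B (D z) - D (B z) != 0].
  have -> : [set z | B (D z) - D (B z) != 0] =
      (fun z => B (D z) - D (B z)) @^-1` ~` [set 0].
    by apply/seteqP; split=> z /= /eqP.
  apply: open_comp; first by move=> z _; exact: cBD.
  by apply: closed_openC; apply: accessible_closed_set1;
    apply: hausdorff_accessible; exact: norm_hausdorff.
have xBD : [set z | B (D z) - D (B z) != 0] !=set0.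
  by exists x; rewrite /= subr_eq0.
case: (Aspan _ xBD oBD) => z /= [/eqP + [m [c [s [sA zE]]]]]; apply.
rewrite zE [D _]linear_sum [B (\sum_(k < m) c k *: s k)]linear_sum.
rewrite [B _]linear_sum [D _]linear_sum -sumrB big1// => k _.
rewrite /=.
have DZ c' w : D (c' *: w) = c' *: D w by rewrite linearZ.
have BZ c' w : B (c' *: w) = c' *: B w by rewrite linearZ.
by rewrite !(DZ, BZ) (eig _ (sA k)) subrr.
Qed.

(* The second moment <psi|A^2|psi> is read as |A psi|^2, which makes sense on
   the whole domain of A and not only on that of A^2. For symmetric A the
   complex number below is real, so that Re loses nothing. *)
Definition qvariance A psi : R :=
  complex.Re (ip (op_app A psi) (op_app A psi) - ip (op_app A psi) psi ^+ 2).

End OnHilbert.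

(* t exhibits K as the n-th Hilbert tensor power of V, with
   t x = x_0 (x) ... (x) x_{n-1}. These properties determine (K, t) up to a
   unique unitary. *)
Record is_tensor_power (n : nat) (V K : hilbertType R)
    (t : ('I_n -> V) -> K) : Prop := {
  tensor_linear : forall (x : 'I_n -> V) (i : 'I_n),
    linear (fun u : V => t (dfwith x i u)) ;
  tensor_ip : forall x y : 'I_n -> V,
    ip (t x) (t y) = \prod_(i < n) ip (x i) (y i) ;
  tensor_dense : dense (lin_span (range t)) }.

Section TensorOperators.
Variables (n : nat) (V K : hilbertType R) (t : ('I_n -> V) -> K).
Variable H : set (V * V).

(* H_i = 1 (x) ... (x) H (x) ... (x) 1, as the closure of the operator
   x_0 (x) ... (x) x_{n-1} |-> x_0 (x) ... (x) H x_i (x) ... (x) x_{n-1}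
   on the span of the product vectors with x_i in the domain of H. *)
Definition local_op (i : 'I_n) : set (K * K) :=
  closure (lin_span [set p | exists (x : 'I_n -> V) (y : V),
    H (x i, y) /\ p = (t x, t (dfwith x i y))]).

Definition collective_op : set (K * K) := op_sum local_op.

Definition rotated_op (alpha : 'M[R]_n) (i : 'I_n) : set (K * K) :=
  op_sum (fun j => op_scale (alpha i j)%:C (local_op j)).

End TensorOperators.
End Operators.

(* Main.v *)
Require Import Defs.
From HB Require Import structures.
From mathcomp Require Import all_boot all_order all_algebra.
From mathcomp Require Import complex ring.
From mathcomp Require Import all_classical all_reals all_analysis.
Import Order.TTheory GRing.Theory Num.Theory.
Import numFieldNormedType.Exports.
Local Open Scope classical_set_scope.
Local Open Scope ring_scope.

(** Put [u_i = H_i psi - <H_i> psi], so that a real combination [sum_i a_i H_i]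
    has variance [|sum_i a_i u_i|^2]. As [alpha] is orthogonal, the variances of
    the [P_j] and those of the [H_i] have the same sum, whence
    [Var H_coll = n Var P_1 = n (sum_i Var H_i - sum_(j >= 2) Var P_j)
                <= n^2 max_i Var H_i - n sum_(j >= 2) Var P_j],
    and equality forces [Var P_j = 0] for [j >= 2]. Conversely, if these vanish,
    then inverting [alpha] gives [u_i = p_1 / sqrt n] with [p_1 = sum_j u_j / sqrt n],
    so all the [u_i], hence all the [Var H_i], are equal. Unboundedness only
    matters for [H_i psi] being well defined with [<H_i>] real: the closure of a
    densely defined symmetric operator is single-valued and symmetric. *)

(** * Closed conditions, density and linear spans *)

Lemma closed_zeros (K : numFieldType) (T : topologicalType) (f : T -> K^o) :
  continuous f -> closed [set x | f x = 0].
Proof.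
move=> cf; have -> : [set x | f x = 0] = f @^-1` [set 0] by [].
apply: preimage_closed => [x _|]; first exact: cf.
by apply: accessible_closed_set1; apply: hausdorff_accessible;
  exact: norm_hausdorff.
Qed.

Lemma dense_sub_closed (T : topologicalType) (S C : set T) :
  dense S -> S `<=` C -> closed C -> forall x, C x.
Proof.
move=> dS SC cC x; apply: contrapT => nCx.
(* If [x] were outside [C], the complement of [C] would be open and nonempty, so it would meet
   [S]. *)
by case: (dS (~` C) (ex_intro _ x nCx) (closed_openC cC)) => y [] /[swap] /SC.
Qed.

Lemma lin_span_sub (R : realType) (V : lmodType R[i]) (S C : set V) :
  S `<=` C -> C 0 -> (forall c x y, C x -> C y -> C (c *: x + y)) ->
  lin_span S `<=` C.
Proof.
move=> SC C0 Clin _ [m [c [s [sS ->]]]].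
elim/big_rec: _ => // k x _; apply: Clin; exact: SC.
Qed.

(** * Continuity of the inner product and symmetric pairs *)

Section InnerProduct.
Context {R : realType} {V : hilbertType R}.
Implicit Types (x y z psi : V).

Lemma bounded_linear_functional_continuous (f : V -> R[i]^o) (M : R[i]) :
  linear f -> 0 <= M -> (forall x, `|f x| <= M * `|x|) -> continuous f.
Proof.
move=> flin M0 fM.
pose g : {linear V -> R[i]^o} := HB.pack f (GRing.isLinear.Build _ _ _ _ f flin).
apply: (@bounded_linear_continuous _ V R[i]^o g).
apply/linear_boundedP; near=> r => x.
apply: (le_trans (fM x)); apply: ler_wpM2r => //.
by near: r; apply: nbhs_pinfty_ge; rewrite ger0_real.
Unshelve. all: by end_near. Qed.

Lemma ip_linearl z : linear (fun x => ip x z : R[i]^o).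
Proof. by move=> c x y; rewrite linearPl. Qed.

Lemma ip_continuousl z : continuous (fun x => ip x z : R[i]^o).
Proof.
apply: (@bounded_linear_functional_continuous _ `|z|) => [||x] //.
  exact: ip_linearl.
by rewrite mulrC ip_CauchySchwarz.
Qed.

Lemma ip0_dense_span (S : set V) y :
  dense (lin_span S) -> (forall x, S x -> ip x y = 0) -> y = 0.
Proof.
move=> dS Sy; have zy x : ip x y = 0.
  apply: (dense_sub_closed _ _ [set z | ip z y = 0] dS).
    apply: lin_span_sub => //=; first by rewrite linear0l.
    by move=> c u v uy vy; rewrite linearPl /= uy vy mulr0 addr0.
  by apply: closed_zeros; exact: ip_continuousl.
(* Orthogonality to every vector includes [y] itself. *)
by apply/eqP; rewrite -normr_eq0 -sqrf_eq0 -ip_norm zy.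
Qed.

(** Symmetry at the level of two points of a graph. For [p = q = (psi, A psi)] it says that the mean
    of [A] in [psi] is real. *)
Definition formally_adjoint (p q : V * V) := ip p.2 q.1 = ip p.1 q.2.

Lemma formally_adjointC p q : formally_adjoint p q -> formally_adjoint q p.
Proof.
by rewrite /formally_adjoint => pq; rewrite ip_conj -pq -ip_conj.
Qed.

(** For fixed [q] the condition on [p] is linear and closed, hence passes from generators to their
    closed span. *)
Lemma formally_adjoint_closure (S : set (V * V)) q :
  (forall p, S p -> formally_adjoint p q) ->
  forall p, closure (lin_span S) p -> formally_adjoint p q.
Proof.
move=> Sq p; suff : closure (lin_span S) `<=` [set p | ip p.2 q.1 - ip p.1 q.2 = 0].
  by move=> /[apply] /eqP; rewrite subr_eq0 => /eqP.
move=> z Sz; have cz : closed [set p : V * V | ip p.2 q.1 - ip p.1 q.2 = 0].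
  apply: (@closed_zeros R[i]) => x.
  apply: (@cvgB _ R[i]^o).
    exact: (continuous_comp (@cvg_snd _ _ _ _ _) (@ip_continuousl q.1 x.2)).
  exact: (continuous_comp (@cvg_fst _ _ _ _ _) (@ip_continuousl q.2 x.1)).
apply: cz; apply: closure_subset Sz; apply: lin_span_sub => /=.
- by move=> x /Sq xq /=; rewrite xq subrr.
- by rewrite !linear0l subrr.
move=> c x y /eqP + /eqP; rewrite !subr_eq0 => /eqP xq /eqP yq.
by rewrite /= !linearPl /= xq yq subrr.
Qed.

Lemma op_app_unique (A : set (V * V)) x y :
  A (x, y) -> (forall y', A (x, y') -> y' = y) -> op_app A x = y.
Proof. exact: xget_unique. Qed.

Lemma self_adjoint_symmetric (A : set (V * V)) p q :
  self_adjoint A -> A p -> A q -> formally_adjoint p q.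
Proof.
by case=> _ _ Aadj; rewrite -{2}Aadj => Ap /(_ p Ap).
Qed.

End InnerProduct.

(** * The operators [H_i] on the tensor power: symmetric and single-valued *)

Section LocalOperators.
Context {R : realType} {n : nat} {V K : hilbertType R} {t : ('I_n -> V) -> K}.
Context {H : set (V * V)}.
Hypothesis tP : is_tensor_power t.
Hypothesis H_sa : self_adjoint H.

Lemma tensor_norm x : `|t x| = \prod_(i < n) `|x i|.
Proof.
apply/eqP; rewrite -(@eqrXn2 _ 2) ?prodr_ge0// -ip_norm (tensor_ip tP) -prodrXl.
by apply/eqP/eq_bigr => i _; rewrite ip_norm.
Qed.

Lemma dfwith_id (T : Type) (x : 'I_n -> T) i : dfwith x i (x i) = x.
Proof. by apply/funext => j; case: dfwithP. Qed.

Lemma dfwith_dfwith (T : Type) (x : 'I_n -> T) i u v :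
  dfwith (dfwith x i u) i v = dfwith x i v.
Proof.
apply/funext => j; case: (dfwithP (dfwith x i u)) => [|k ik].
  by rewrite dfwithin.
by rewrite !dfwithout.
Qed.

Lemma ip_tensor_dfwith x z i u :
  ip (t (dfwith x i u)) (t z) =
  ip u (z i) * \prod_(j < n | j != i) ip (x j) (z j).
Proof.
rewrite (tensor_ip tP) (bigD1 i) //= dfwithin; congr (_ * _).
by apply: eq_bigr => j ji; rewrite dfwithout // eq_sym.
Qed.

(** The norm of a product vector is the product of the norms, so the functional is bounded in the
    free slot. *)
Lemma tensor_slot_continuous x i y :
  continuous (fun u => ip (t (dfwith x i u)) y : R[i]^o).
Proof.
apply: (@bounded_linear_functional_continuous _ _ _
  ((\prod_(j < n | j != i) `|x j|) * `|y|)) => [c u v||u].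
- by rewrite (tensor_linear tP) linearPl.
- by rewrite mulr_ge0 ?prodr_ge0.
apply: (le_trans (ip_CauchySchwarz _ _)); rewrite tensor_norm (bigD1 i) //=.
rewrite dfwithin (eq_bigr (fun j => `|x j|)) => [|j ji].
  by rewrite -mulrA mulrC.
by rewrite dfwithout // eq_sym.
Qed.

Lemma local_op_symmetric i p q :
  local_op t H i p -> local_op t H i q -> formally_adjoint p q.
Proof.
(* The closure argument is applied once to each of [p] and [q]. For two generators, symmetry of [H]
   in slot [i] remains, the other slots contributing equal factors. *)
move=> + Hq; apply: formally_adjoint_closure => {}p Gp.
apply: formally_adjointC; move: q Hq; apply: formally_adjoint_closure => q Gq.
case: Gq Gp => [x [y [Hx ->]]] [z [w [Hz ->]]].
rewrite /formally_adjoint /= ip_tensor_dfwith.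
rewrite [RHS]ip_conj ip_tensor_dfwith rmorphM rmorph_prod /=.
have /= -> := self_adjoint_symmetric _ _ _ H_sa Hz Hx.
by rewrite -ip_conj; congr (_ * _); apply: eq_bigr => j _; rewrite -ip_conj.
Qed.

(* [b' - b] is orthogonal to every [t x] with [x i] in the domain of [H], hence by
   continuity in the slot [i] to every [t x]. *)
Lemma local_op_functional i a b b' :
  local_op t H i (a, b) -> local_op t H i (a, b') -> b' = b.
Proof.
move=> ab ab'; apply/eqP; rewrite -subr_eq0; apply/eqP.
apply: (ip0_dense_span _ _ (tensor_dense tP)) => _ [x _ <-].
have Hdense : dense (op_dom H) by case: H_sa.
rewrite -(dfwith_id _ x i).
apply: (dense_sub_closed _ _
  [set u | ip (t (dfwith x i u)) (b' - b) = 0] Hdense); last first.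
  by apply: closed_zeros; exact: tensor_slot_continuous.
move=> u [v Huv] /=.
(* Pairing this generator with [(a, b)] and with [(a, b')] gives the same number
   [ip (t (dfwith x i v)) a] both times. *)
have G : local_op t H i (t (dfwith x i u), t (dfwith x i v)).
  apply: subset_closure; exists 1%N, (fun=> 1), (fun=> (t (dfwith x i u), t (dfwith x i v))).
  split=> [_|]; last by rewrite big_ord1 scale1r.
  by exists (dfwith x i u), v; rewrite dfwithin dfwith_dfwith.
have := local_op_symmetric _ _ _ G ab'; have := local_op_symmetric _ _ _ G ab.
by rewrite /formally_adjoint /= linearBr /= => -> ->; rewrite subrr.
Qed.

End LocalOperators.

(** * Variance as the squared norm of a deviation vector *)

Section Variance.
Context {R : realType} {K : hilbertType R}.
Implicit Types (x y z psi h : K).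

Definition re_ip x y : R := complex.Re (ip x y).

Lemma re_ipC x y : re_ip x y = re_ip y x.
Proof. by rewrite /re_ip ip_conj; case: (ip y x). Qed.

Lemma re_ipZl (a : R) x z : re_ip (a%:C%C *: x) z = a * re_ip x z.
Proof.
by rewrite /re_ip linearZl_LR /=; case: (ip x z) => b c /=; rewrite mul0r subr0.
Qed.

Lemma re_ip_suml (I : finType) (a : I -> R) (u : I -> K) z :
  re_ip (\sum_k (a k)%:C%C *: u k) z = \sum_k a k * re_ip (u k) z.
Proof.
rewrite /re_ip linear_sumlz raddf_sum; apply: eq_bigr => k _.
exact: re_ipZl.
Qed.

Lemma re_ip_ge0 x : 0 <= re_ip x x.
Proof.
have : 0 <= ip x x by rewrite ip_norm exprn_ge0.
by rewrite /re_ip lecE => /andP[].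
Qed.

Lemma re_ip_eq0 x : re_ip x x = 0 -> x = 0.
Proof.
move=> x0; apply/eqP; rewrite -normr_eq0 -sqrf_eq0 -ip_norm.
(* In the order on complex numbers, [0 <= z] forces [z] to have zero imaginary part. *)
have : 0 <= ip x x by rewrite ip_norm exprn_ge0.
by rewrite lecE eq_complex => /andP[-> _]; rewrite -/(re_ip x x) x0 eqxx.
Qed.

(** For a unit vector [psi], the component of [h] orthogonal to [psi]. It is linear in [h], which
    variance is not. *)
Definition deviation psi h : K := h - ip h psi *: psi.

Lemma deviation_sum psi (I : finType) (a : I -> R[i]) (h : I -> K) :
  deviation psi (\sum_k a k *: h k) = \sum_k a k *: deviation psi (h k).
Proof.
rewrite /deviation linear_sumlz scaler_suml -sumrB; apply: eq_bigr => k _.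
by rewrite linearZl_LR scalerBr scalerA.
Qed.

(** Since the mean [ip h psi] is real and [psi] has norm 1, expanding the squared norm of the
    deviation leaves [ip h h] minus the squared mean. *)
Lemma qvarianceE (A : set (K * K)) psi :
  `|psi| = 1 -> formally_adjoint (psi, op_app A psi) (psi, op_app A psi) ->
  qvariance A psi = re_ip (deviation psi (op_app A psi)) (deviation psi (op_app A psi)).
Proof.
rewrite /formally_adjoint /= /qvariance /re_ip /deviation.
set h := op_app A psi => psi1 hpsi.
have psipsi : ip psi psi = 1 by rewrite ip_norm psi1 expr1n.
have hR : (ip h psi)^* = ip h psi by rewrite -ip_conj.
rewrite !(ipBl, ipBr, ipZl, ipZr) psipsi -hpsi hR mulr1 subrr subr0.
by rewrite expr2.
Qed.

(** * Orthogonal mixing of a family of vectors *)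

Section Rotation.
Context {n : nat} (alpha : 'M[R]_n) (u : 'I_n -> K).
Hypothesis alpha_orthogonal : alpha *m alpha^T = 1%:M.
Let p j := \sum_k (alpha j k)%:C%C *: u k.

Lemma rotationK k : u k = \sum_j (alpha j k)%:C%C *: p j.
Proof.
(* A one-sided inverse of a square matrix is two-sided, so the columns of [alpha] are orthonormal
   too. *)
have aT k' : \sum_j alpha j k * alpha j k' = (k == k')%:R.
  have := congr1 (fun A : 'M[R]_n => A k k') (mulmx1C alpha_orthogonal).
  by rewrite !mxE => <-; apply: eq_bigr => j _; rewrite mxE.
under eq_bigr do rewrite scaler_sumr.
rewrite exchange_big (bigD1 k) //= [X in _ + X]big1 => [|k' k'k];
  under eq_bigr do rewrite scalerA -rmorphM.
  by rewrite -scaler_suml -rmorph_sum aT eqxx scale1r addr0.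
by rewrite -scaler_suml -rmorph_sum aT eq_sym (negPf k'k) scale0r.
Qed.

Lemma rotation_sum_sqr :
  \sum_j re_ip (p j) (p j) = \sum_k re_ip (u k) (u k).
Proof.
rewrite (eq_bigr _ (fun j _ => re_ip_suml _ (alpha j) u (p j))).
rewrite exchange_big; apply: eq_bigr => k _ /=.
(* Only one of the two factors [u k] is expanded back in the [p j]. *)
rewrite {2}(rotationK k) re_ip_suml.
by apply: eq_bigr => j _; rewrite re_ipC.
Qed.

End Rotation.

(** * The equality case, for arbitrary vectors [u] *)

Section CollectiveBound.
Context {n : nat} (alpha : 'M[R]_n.+1) (u : 'I_n.+1 -> K).
Hypothesis alpha_orthogonal : alpha *m alpha^T = 1%:M.
Hypothesis alpha_row0 : forall j, alpha ord0 j = 1 / Num.sqrt n.+1%:R.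
Let p j := \sum_k (alpha j k)%:C%C *: u k.

Lemma rotation_eq : (forall j, j != ord0 -> p j = 0) -> forall i k, u i = u k.
Proof.
move=> p0; suff ue i : u i = (1 / Num.sqrt n.+1%:R)%:C%C *: p ord0.
  by move=> i k; rewrite !ue.
rewrite (rotationK _ u alpha_orthogonal i) (bigD1 ord0) //= [X in _ + X]big1 => [|j /p0 pj].
  by rewrite addr0 alpha_row0.
by rewrite -/(p j) pj scaler0.
Qed.

Lemma sum_sqr : re_ip (\sum_k u k) (\sum_k u k) = n.+1%:R * re_ip (p ord0) (p ord0).
Proof.
have s0 : Num.sqrt n.+1%:R != 0 :> R by rewrite gt_eqF // sqrtr_gt0 ltr0n.
have -> : p ord0 = (1 / Num.sqrt n.+1%:R)%:C%C *: \sum_k u k.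
  by rewrite scaler_sumr; apply: eq_bigr => k _; rewrite alpha_row0.
rewrite re_ipZl re_ipC re_ipZl !mulrA.
have sE : Num.sqrt n.+1%:R ^+ 2 = n.+1%:R :> R by rewrite sqr_sqrtr ?ler0n.
set s := Num.sqrt _ in s0 sE *; rewrite -sE.
by field.
Qed.

Lemma collective_bound (W := fun k => re_ip (u k) (u k)) :
  (re_ip (\sum_k u k) (\sum_k u k) = n.+1%:R ^+ 2 * \big[Num.max/W ord0]_i W i
   <-> forall j, j != ord0 -> re_ip (p j) (p j) = 0)
  /\ ((forall j, j != ord0 -> re_ip (p j) (p j) = 0) -> forall i j, W i = W j).
Proof.
have eqW : (forall j, j != ord0 -> re_ip (p j) (p j) = 0) -> forall i j, W i = W j.
  move=> p0 i j; congr (re_ip _ _); apply: rotation_eq => k k0;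
    by apply: re_ip_eq0; exact: p0.
have N0 : n.+1%:R != 0 :> R by rewrite pnatr_eq0.
(* The default [W ord0] is one of the values, so [M] is their true maximum. *)
set M := \big[_/_]_i W i.
have defW : re_ip (p ord0) (p ord0) =
    \sum_k W k - \sum_(j | j != ord0) re_ip (p j) (p j).
  by rewrite -(rotation_sum_sqr _ u alpha_orthogonal) (bigD1 ord0) //= addrK.
split=> //; rewrite sum_sqr expr2 -mulrA; split=> [/(mulfI N0) pM|p0].
  have WM : \sum_k W k <= n.+1%:R * M.
    rewrite mulr_natl -[in leRHS](card_ord n.+1) -sumr_const.
    by apply: ler_sum => k _; exact: le_bigmax.
  (* By [pM] and [WM], the sum of all [W k] is at most its [p ord0] share, so the remaining
     nonnegative terms add up to zero. *)
  have s0 : \sum_(j | j != ord0) re_ip (p j) (p j) == 0.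
    rewrite eq_le sumr_ge0 ?andbT; last by move=> j _; exact: re_ip_ge0.
    by rewrite -(lerD2l (re_ip (p ord0) (p ord0))) addr0 {1}defW subrK pM.
  move: s0; rewrite psumr_eq0 => [/allP s0 j j0|j _]; last exact: re_ip_ge0.
  by apply/eqP; have := s0 j (mem_index_enum j); rewrite j0.
congr (_ * _).
rewrite defW [X in _ - X]big1 // subr0.
have -> : M = W ord0.
  apply/le_anti/andP; split; last exact: le_bigmax.
  by apply: bigmax_le => // i _; rewrite (eqW p0 i ord0).
under eq_bigr => k _ do rewrite (eqW p0 k ord0).
by rewrite sumr_const card_ord mulr_natl.
Qed.

End CollectiveBound.
End Variance.

(** * Reduction of the operator statement to deviation vectors *)

Lemma op_app_sum (R : realType) (n : nat) (K : hilbertType R)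
    (A : 'I_n -> set (K * K)) psi (h : 'I_n -> K) :
  (forall i y, A i (psi, y) <-> y = h i) ->
  op_app (op_sum A) psi = \sum_i h i.
Proof.
move=> Ah; apply: op_app_unique => [|y' [y [Ay /= ->]]].
  by exists h; split=> // i; apply/Ah.
by apply: eq_bigr => i _; apply/Ah/Ay.
Qed.

Theorem mainTheorem2 (R : realType) (n : nat) (V K : hilbertType R)
    (t : ('I_n.+1 -> V) -> K) (H : set (V * V)) (alpha : 'M[R]_n.+1)
    (psi : K)
    (tP : is_tensor_power t)
    (H_sa : self_adjoint H)
    (H_nondeg : nondegenerate_spectrum H)
    (alpha_orthogonal : alpha *m alpha^T = 1%:M)
    (alpha_row0 : forall j, alpha ord0 j = 1 / Num.sqrt n.+1%:R)
    (psi_pure : `|psi| = 1)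
    (psi_dom : forall i, op_dom (local_op t H i) psi) :
  (qvariance (collective_op t H) psi =
     n.+1%:R ^+ 2 *
     \big[Num.max/qvariance (local_op t H ord0) psi]_(i < n.+1)
       qvariance (local_op t H i) psi
   <-> forall j : 'I_n.+1, j != ord0 ->
         qvariance (rotated_op t H alpha j) psi = 0)
  /\ ((forall j : 'I_n.+1, j != ord0 ->
         qvariance (rotated_op t H alpha j) psi = 0) ->
      forall i j : 'I_n.+1,
        qvariance (local_op t H i) psi = qvariance (local_op t H j) psi).
Proof.
have [h hP] := choice (psi_dom : forall i, exists y, local_op t H i (psi, y)).
have hE i y : local_op t H i (psi, y) <-> y = h i.
  by split=> [|->]; [exact: local_op_functional (hP i) | exact: hP].
have h_sym i : formally_adjoint (psi, h i) (psi, h i).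
  exact: local_op_symmetric (hP i) (hP i).
(* Real coefficients are self-conjugate, so real combinations keep a real mean. *)
have sum_sym (a : 'I_n.+1 -> R) :
    formally_adjoint (psi, \sum_k (a k)%:C%C *: h k) (psi, \sum_k (a k)%:C%C *: h k).
  rewrite /formally_adjoint /= linear_sumlz linear_sumr; apply: eq_bigr => k _.
  rewrite linearZl_LR linearZr_LR /=.
  by congr (_ * _); [exact/esym/conjc_real | exact: h_sym].
have localE i : op_app (local_op t H i) psi = h i.
  by apply: op_app_unique => // y /hE.
have rotE j : op_app (rotated_op t H alpha j) psi = \sum_k (alpha j k)%:C%C *: h k.
  apply: op_app_sum => k y; split=> [[z /hE -> //]|->]; by exists (h k).
have collE : op_app (collective_op t H) psi = \sum_k h k by exact: op_app_sum.
pose u i := deviation psi (h i).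
have varL i : qvariance (local_op t H i) psi = re_ip (u i) (u i).
  by rewrite qvarianceE // localE.
have varR j : qvariance (rotated_op t H alpha j) psi =
    re_ip (\sum_k (alpha j k)%:C%C *: u k) (\sum_k (alpha j k)%:C%C *: u k).
  by rewrite qvarianceE // rotE // deviation_sum.
(* The collective operator is treated as the real combination with all coefficients 1. *)
have sum1 (v : 'I_n.+1 -> K) : \sum_k v k = \sum_k (1 : R)%:C%C *: v k.
  by apply: eq_bigr => k _; rewrite scale1r.
have varC : qvariance (collective_op t H) psi = re_ip (\sum_k u k) (\sum_k u k).
  by rewrite qvarianceE // collE sum1 // deviation_sum -sum1.
under eq_bigr do rewrite varL.
rewrite varL varC.
have [bnd eqv] := collective_bound _ u alpha_orthogonal alpha_row0.
have rot0 : (forall j, j != ord0 -> qvariance (rotated_op t H alpha j) psi = 0) <->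
  (forall j, j != ord0 -> re_ip (\sum_k (alpha j k)%:C%C *: u k)
     (\sum_k (alpha j k)%:C%C *: u k) = 0).
  by split=> p0 j /p0; rewrite varR.
split; first by rewrite bnd rot0.
by move=> /rot0 p0 i j; rewrite !varL; exact: eqv.
Qed.
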